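(* Let $\rho\in(0,1)$ and, for each $n$, let $(X_1,\ldots,X_n)$ be jointly normal with $X_i\sim\mathcal N(\mu_i,1)$, $\mu_i\ge0$, and $\operatorname{Corr}(X_i,X_j)=\rho$ for all $i\neq j$. Suppose $\sup_i\mu_i$ is finite. Then, for any $\alpha\in(0,1)$, $$\lim_{n\to\infty}FWER_{Hommel}(n,\alpha,\rho)=0$$ under any configuration of true and false null hypotheses (i.e. whatever the set of indices $i$ with $\mu_i=0$).
   Context: Testing problem: test $H_{0i}:\mu_i=0$ against $H_{1i}:\mu_i>0$, $1\le i\le n$ (so always $\mu_i\ge0$). The p-values are $P_i=1-\Phi(X_i)$, with $\Phi$ the standard normal distribution function, and $P_{(1)}\le\cdots\le P_{(n)}$ are the ordered p-values. For a multiple testing procedure $T$, $V_n(T)$ is the number of type I errors (rejected hypotheses $H_{0i}$ with $\mu_i=0$), and $FWER_T(n,\alpha,\rho)=\mathbb P(V_n(T)\ge1)$, the probability being computed under the equicorrelated model with correlation $\rho$. Hommel's procedure at level $\alpha$: Step 1. Compute $j=\max\{i\in\{1,\ldots,n\}:P_{(n-i+k)}>k\alpha/i\text{ for } k=1,\ldots,i\}$. Step 2. If the maximum in Step 1 does not exist, reject all the hypotheses; otherwise reject all $H_{0i}$ with $P_i\le\alpha/j$. *)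

(* Defs.v *)
From HB Require Import structures.
From mathcomp Require Import all_boot all_order all_algebra.
From mathcomp Require Import all_classical all_reals all_analysis.

Set Implicit Arguments.
Unset Strict Implicit.
Unset Printing Implicit Defensive.

Import Order.TTheory GRing.Theory Num.Theory.
Import numFieldNormedType.Exports.

Local Open Scope classical_set_scope.
Local Open Scope ring_scope.

(* [Y] has law N(m, s^2), with N(m, 0) the point mass at [m]. The case [s = 0]
   is separated because [normal_prob m 0] is the uniform law on [0, 1]. *)
Definition is_normal {d : measure_display} {Omega : measurableType d}
    {R : realType} (P : probability Omega R) (Y : Omega -> R) (m s : R) : Prop :=
  forall A : set R, measurable A ->
    P (Y @^-1` A) = if s == 0 then \d_m A else normal_prob m s A.

(* Joint normality of a random vector: every linear combination of its
   coordinates is univariate normal, possibly degenerate. *)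
Definition jointly_normal {d : measure_display} {Omega : measurableType d}
    {R : realType} (P : probability Omega R) {n : nat}
    (X : 'I_n -> {RV P >-> R}) : Prop :=
  forall a : 'I_n -> R, exists m s : R,
    0 <= s /\ is_normal P (fun w => \sum_(i < n) a i * X i w) m s.

Definition correlation {d : measure_display} {Omega : measurableType d}
    {R : realType} (P : probability Omega R) (Y Z : {RV P >-> R}) : R :=
  fine (covariance P Y Z)
    / (Num.sqrt (fine (variance P Y)) * Num.sqrt (fine (variance P Z))).

Definition Phi {R : realType} (x : R) : R := fine (normal_prob 0 1 `]-oo, x]).

Definition pvalue {R : realType} {n : nat} (x : 'I_n -> R) (i : 'I_n) : R :=
  1 - Phi (x i).

(* The k-th smallest p-value P_(k), for k = 1, ..., n; the subscript is
   1-based, and the value 0 outside this range is never used. *)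
Definition ordered_pvalue {R : realType} {n : nat} (p : 'I_n -> R) (k : nat) : R :=
  nth 0 (sort <=%R [seq p i | i <- enum 'I_n]) k.-1.

(* A multiple testing procedure maps the n p-values to the set of indices of
   the rejected null hypotheses. *)
Definition procedure (R : realType) := forall n : nat, ('I_n -> R) -> {set 'I_n}.

Definition hommel_admissible {R : realType} (alpha : R) {n : nat}
    (p : 'I_n -> R) (i : nat) : bool :=
  (1 <= i <= n)%N &&
  all (fun k => k%:R * alpha / i%:R < ordered_pvalue p (n - i + k)) (iota 1 i).

(* Indices i range over {0, ..., n}; 0 is excluded by [hommel_admissible]. *)
Definition hommel {R : realType} (alpha : R) : procedure R := fun n p =>
  if [exists i : 'I_n.+1, hommel_admissible alpha p i] then
    let j := \max_(i < n.+1 | hommel_admissible alpha p i) (i : nat) in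
    [set i | p i <= alpha / j%:R]%SET
  else [set: 'I_n]%SET.

Definition type1_errors {R : realType} (T : procedure R) {n : nat}
    (mu x : 'I_n -> R) : nat :=
  #|[set i in T n (pvalue x) | mu i == 0]%SET|.

Definition FWER {R : realType} (T : procedure R) {d : measure_display}
    {Omega : measurableType d} (P : probability Omega R) {n : nat}
    (mu : 'I_n -> R) (X : 'I_n -> {RV P >-> R}) : \bar R :=
  P [set w | (1 <= type1_errors T mu (fun i => X i w))%N].

(* Main.v *)
Require Import Defs.
From HB Require Import structures.
From mathcomp Require Import all_boot all_order all_algebra.
From mathcomp Require Import all_classical all_reals all_analysis.
From mathcomp Require Import measurable_realfun ring lra.

Set Implicit Arguments.
Unset Strict Implicit.
Unset Printing Implicit Defensive.

Import Order.TTheory GRing.Theory Num.Theory.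
Import numFieldNormedType.Exports.

Local Open Scope classical_set_scope.
Local Open Scope ring_scope.

(* The sample mean Xb is stochastically bounded, while the residuals X_i - Xb are
   centred up to a bounded shift, have variance at most 1 - rho < 1 and are
   negatively correlated. Hence, with high probability, at least c n of the
   p-values exceed alpha, so that Hommel's index j is at least c n and every
   rejected p-value is at most alpha / (c n), i.e. some X_i is beyond the
   1 - alpha / (c n) quantile of N(0, 1). On {Xb < K} this forces a residual beyond
   essentially the same quantile; as the upper tail of N(m, s^2) with s < 1 is
   negligible compared with that of N(0, 1), a union bound over i concludes.
   Laws of linear combinations are identified through their first two moments,
   obtained from explicit Gaussian integrals of exp (a y) and exp (- b y^2) and
   from exp x >= 1 + x. *)

(** * Measurability of sublevel and superlevel sets *)

Section sublevel_sets.
Context {R : realType} {d : measure_display} {T : measurableType d}.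
Implicit Types f : T -> R.

Lemma measurable_sublevel f (c : R) :
  measurable_fun setT f -> measurable [set x | f x <= c].
Proof.
move=> mf; rewrite (_ : [set x | _] = setT `&` f @^-1` `]-oo, c]); first exact: mf.
by rewrite setTI; apply/seteqP; split=> x /=; rewrite in_itv.
Qed.

Lemma measurable_superlevel f (c : R) :
  measurable_fun setT f -> measurable [set x | c <= f x].
Proof.
move=> mf; rewrite (_ : [set x | _] = setT `&` f @^-1` `[c, +oo[); first exact: mf.
by rewrite setTI; apply/seteqP; split=> x /=; rewrite in_itv/= andbT.
Qed.

End sublevel_sets.

(** * Gaussian integrals *)

Section normal_law.
Context {R : realType}.
Notation lambda := (@lebesgue_measure R).

(** Change of variables through the Radon-Nikodym derivative, which agrees almost everywhere with
    [normal_pdf] because both have the same integral over every measurable set. *)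
Lemma ge0_integral_normal_prob (m s : R) (f : R -> R) :
  measurable_fun setT f -> (forall y, 0 <= f y) ->
  (\int[normal_prob m s]_y (f y)%:E =
   \int[lambda]_y (f y * normal_pdf m s y)%:E)%E.
Proof.
move=> mf f0; have dom := normal_prob_dominates m s.
have mf' : measurable_fun setT (fun y => (f y)%:E) by exact/measurable_EFinP.
rewrite -(Radon_Nikodym_SigmaFinite.change_of_variables dom)//=.
have mpdf : measurable_fun setT (fun x => (normal_pdf m s x)%:E).
  by apply/measurable_EFinP; exact: measurable_normal_pdf.
under [RHS]eq_integral do rewrite EFinM.
apply: ae_eq_integral => //.
- apply: emeasurable_funM => //.
  exact: measurable_int (Radon_Nikodym_SigmaFinite.f_integrable dom).
- exact: emeasurable_funM.
- apply: ae_eqe_mul2l; apply: integral_ae_eq => //.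
    exact: Radon_Nikodym_SigmaFinite.f_integrable.
  by move=> E _ mE; rewrite -Radon_Nikodym_SigmaFinite.f_integral.
Qed.

Context {d : measure_display} {Omega : measurableType d}
  (P : probability Omega R).

Lemma ge0_integral_is_normal (Y : Omega -> R) (m s : R) (f : R -> R) :
  measurable_fun setT Y -> is_normal P Y m s -> s != 0 ->
  measurable_fun setT f -> (forall y, 0 <= f y) ->
  (\int[P]_w (f (Y w))%:E = \int[lambda]_y (f y * normal_pdf m s y)%:E)%E.
Proof.
move=> mY nY s0 mf f0.
have mf' : measurable_fun setT (fun y => (f y)%:E) by exact/measurable_EFinP.
(* [Y] is repackaged with codomain [measurableTypeR R], so that its distribution can be compared
   with [normal_prob]. *)
have mY' : measurable_fun setT (Y : Omega -> measurableTypeR R) by exact: mY.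
pose Z : {RV P >-> measurableTypeR R} :=
  HB.pack Y (isMeasurableFun.Build _ _ _ _ _ mY').
rewrite -(ge0_integral_distribution Z (f := fun y => (f y)%:E))//=.
rewrite -ge0_integral_normal_prob//.
apply: eq_measure_integral => A mA _ /=.
by have := nY A mA; rewrite (negbTE s0).
Qed.

Lemma ge0_integral_is_normal0 (Y : Omega -> R) (m : R) (f : R -> R) :
  measurable_fun setT Y -> is_normal P Y m 0 ->
  measurable_fun setT f -> (forall y, 0 <= f y) ->
  (\int[P]_w (f (Y w))%:E = (f m)%:E)%E.
Proof.
move=> mY nY mf f0.
have mf' : measurable_fun setT (fun y => (f y)%:E) by exact/measurable_EFinP.
pose Z : {RV P >-> R} := HB.pack Y (isMeasurableFun.Build _ _ _ _ _ mY).
rewrite -(ge0_integral_distribution Z (f := fun y => (f y)%:E))//=.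
rewrite (@eq_measure_integral _ _ _ _ (\d_m)); last first.
  by move=> A mA _ /=; have := nY A mA; rewrite eqxx.
by rewrite integral_dirac//= diracT mul1e.
Qed.

(** Completing the square: [expR (l * y)] times the density of N(m, s^2) is a constant times the
    density of N(m + l s^2, s^2). *)
Lemma mgf_is_normal (Y : Omega -> R) (m s l : R) :
  measurable_fun setT Y -> is_normal P Y m s ->
  (\int[P]_w (expR (l * Y w))%:E = (expR (l * m + l ^+ 2 * s ^+ 2 / 2))%:E)%E.
Proof.
move=> mY nY.
have mf : measurable_fun setT (fun y : R => expR (l * y)).
  by apply: measurableT_comp => //; exact: measurable_funM.
have [s0|s0] := eqVneq s 0.
  rewrite s0 in nY *.
  rewrite (ge0_integral_is_normal0 (f := fun y => expR (l * y)) mY nY)//.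
  by rewrite expr0n/= mulr0 mul0r addr0.
rewrite (ge0_integral_is_normal (f := fun y => expR (l * y)) mY nY s0)//.
transitivity (\int[lambda]_y ((expR (l * m + l ^+ 2 * s ^+ 2 / 2))%:E *
    (normal_pdf (m + l * s ^+ 2) s y)%:E))%E.
  apply: eq_integral => y _; rewrite -EFinM; congr EFin.
  rewrite !normal_pdfE// /normal_fun mulrCA [RHS]mulrCA -!expRD.
  by congr (_ * expR _); field.
rewrite integralZl//; last exact: integrable_normal_pdf.
by rewrite integral_normal_pdf mule1.
Qed.

(* With [2 theta s^2 = 1 / r^2 - 1], the density of N(m, s^2) times
   exp(- theta (y - m)^2) is [r] times the density of N(m, (r s)^2). *)
Lemma gauss_transform_is_normal (Y : Omega -> R) (m s r : R) :
  measurable_fun setT Y -> is_normal P Y m s -> s != 0 -> 0 < r ->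
  (\int[P]_w (expR (- ((1 / r ^+ 2 - 1) / (2 * s ^+ 2)) * (Y w - m) ^+ 2))%:E
   = r%:E)%E.
Proof.
move=> mY nY s0 r0.
set th := (1 / r ^+ 2 - 1) / (2 * s ^+ 2).
have mf : measurable_fun setT (fun y : R => expR (- th * (y - m) ^+ 2)).
  apply: measurableT_comp => //; apply: measurable_funM => //.
  by apply: measurable_funX; exact: measurable_funB.
rewrite (ge0_integral_is_normal (f := fun y => expR (- th * (y - m) ^+ 2)) mY nY s0)//.
have rs0 : r * s != 0 by rewrite mulf_neq0// gt_eqF.
transitivity (\int[lambda]_y (r%:E * (normal_pdf m (r * s) y)%:E))%E.
  apply: eq_integral => y _; rewrite -EFinM; congr EFin.
  rewrite !normal_pdfE// /normal_fun mulrCA -expRD [RHS]mulrA.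
  congr (_ * expR _); last first.
    by rewrite /th; field; rewrite s0 gt_eqF.
  rewrite /normal_peak (_ : (r * s) ^+ 2 * pi *+ 2 = r ^+ 2 * (s ^+ 2 * pi *+ 2)).
    rewrite sqrtrM ?sqr_ge0// sqrtr_sqr gtr0_norm// invfM mulrA divff ?mul1r//.
    by rewrite gt_eqF.
  by ring.
rewrite integralZl//; last exact: integrable_normal_pdf.
by rewrite integral_normal_pdf mule1.
Qed.

End normal_law.

(** * Mean and variance of a normal variable *)

Section normal_moments.
Context {R : realType} {d : measure_display} {Omega : measurableType d}
  (P : probability Omega R) (Y : Omega -> R) (m s : R).
Hypotheses (mY : measurable_fun setT Y) (nY : is_normal P Y m s).

Let integrable_expR (a : R) : P.-integrable setT (fun w => (expR (a * Y w))%:E).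
Proof.
apply/integrableP; split.
  apply/measurable_EFinP/measurableT_comp => //; exact: measurable_funM.
under eq_integral do rewrite /= ger0_norm ?expR_ge0//.
by rewrite (mgf_is_normal _ mY nY) ltry.
Qed.

Let abs_le_expR (x : R) : `|x| <= expR x + expR (- x).
Proof.
have h1 := expR_ge1Dx x; have h2 := expR_ge1Dx (- x).
have h3 := expR_ge0 x; have h4 := expR_ge0 (- x).
by rewrite ler_norml; apply/andP; split; lra.
Qed.

Lemma integrable_is_normal : P.-integrable setT (EFin \o Y).
Proof.
have := integrableD measurableT (integrable_expR 1) (integrable_expR (-1)).
apply: le_integrable => //; first exact/measurable_EFinP.
move=> w _; rewrite /= lee_fin; apply: (le_trans (abs_le_expR (Y w))).
by rewrite mul1r mulN1r ler_norm.
Qed.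

(** Integrates [1 + x <= expR x] at [x = a * (Y - m)] and evaluates the right side by the moment
    generating function. *)
Let expectation_bound (a : R) :
  a * (fine ('E_P[Y])%E - m) + 1 <= expR (a ^+ 2 * s ^+ 2 / 2).
Proof.
have iY := integrable_is_normal.
have EY : ('E_P[Y])%E = (fine ('E_P[Y])%E)%:E.
  by rewrite fineK// unlock integrable_fin_num.
have : (\int[P]_w (1 + a * (Y w - m))%:E <=
        \int[P]_w ((expR (- (a * m)))%:E * (expR (a * Y w))%:E))%E.
  apply: le_integral => //.
  - have -> : (fun w => (1 + a * (Y w - m))%:E) =
        (cst (1 - a * m)%:E \+ (fun w => a%:E * (Y w)%:E))%E.
      by apply/funext => w; rewrite /= -EFinM -EFinD; congr EFin; ring.
    apply: integrableD => //; last exact: integrableZl.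
    exact: finite_measure_integrable_cst.
  - exact: integrableZl.
  - move=> w _; rewrite -EFinM lee_fin -expRD.
    by apply: le_trans (expR_ge1Dx _) _; rewrite ler_expR; lra.
rewrite integralZl// (mgf_is_normal _ mY nY) -EFinM -expRD.
have -> : (\int[P]_w (1 + a * (Y w - m))%:E =
           (1 - a * m + a * fine ('E_P[Y])%E)%:E)%E.
  under eq_integral => w _.
    rewrite (_ : 1 + a * (Y w - m) = (1 - a * m) + a * Y w); last by ring.
    rewrite EFinD EFinM; over.
  rewrite integralD//=; [|exact: finite_measure_integrable_cst|exact: integrableZl].
  rewrite integral_cst//= [X in (_ * X)%E]probability_setT mule1.
  rewrite integralZl//; have -> : (\int[P]_w (Y w)%:E = (fine ('E_P[Y])%E)%:E)%E.
    by rewrite -EY unlock.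
  by rewrite -EFinM -EFinD.
by rewrite lee_fin addrA (addrC (- _)) subrr add0r; lra.
Qed.

(** In [expectation_bound] the left side is linear in [a] while the exponent on the right is
    quadratic, so a nonzero slope [D] is refuted by a small [a] of the same sign. *)
Lemma expectation_is_normal : ('E_P[Y])%E = m%:E.
Proof.
have -> : ('E_P[Y])%E = (fine ('E_P[Y])%E)%:E.
  by rewrite fineK// unlock integrable_fin_num// integrable_is_normal.
congr EFin; set e := fine _.
pose D := e - m; have D1 a : a * D + 1 <= expR (a ^+ 2 * s ^+ 2 / 2).
  exact: expectation_bound.
suff : D = 0 by rewrite /D; lra.
apply/eqP/contraT => D0.
have D20 : 0 < D ^+ 2 by rewrite exprn_even_gt0.
have s20 : 0 <= s ^+ 2 by exact: sqr_ge0.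
(* The test point is [a = t * D]; this [t] keeps [t * s ^+ 2 + t * D ^+ 2] below 1. Multiplying by
   [expR (- x) >= 1 - x] then leaves a polynomial inequality. *)
pose t := (1 + s ^+ 2 + D ^+ 2)^-1.
have ht : t * (1 + s ^+ 2 + D ^+ 2) = 1 by rewrite mulVf// gt_eqF//; lra.
have t0 : 0 < t by rewrite invr_gt0; lra.
have := D1 (t * D); set x := (_ / 2) => h.
have x1 := expR_ge1Dx (- x).
have xE : x = t ^+ 2 * (D ^+ 2 * s ^+ 2) / 2 by rewrite /x; ring.
have hx : (t * D * D + 1) * (1 - x) <= 1.
  apply: (@le_trans _ _ (expR x * expR (- x))); last by rewrite -expRD subrr expR0.
  have hD : 0 <= t * D * D + 1 by have := mulr_ge0 (ltW t0) (ltW D20); lra.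
  have [x0|x0] := leP 0 (1 - x); first exact: ler_pM.
  apply: (@le_trans _ _ 0); first by rewrite nmulr_lle0.
  by rewrite mulr_ge0// expR_ge0.
have hts : t * s ^+ 2 <= 1 by rewrite -ht ler_pM2l//; lra.
have htD : t * D ^+ 2 <= 1 by rewrite -ht ler_pM2l//; lra.
have htsD : t * s ^+ 2 + t * D ^+ 2 < 1 by nra.
have key : t * D ^+ 2 * (1 - t * s ^+ 2 / 2 * (1 + t * D ^+ 2)) <= 0.
  by move: hx; rewrite xE => hx; nra.
have : 0 < 1 - t * s ^+ 2 / 2 * (1 + t * D ^+ 2).
  have := mulr_ge0 (ltW t0) s20; have := mulr_ge0 (ltW t0) (ltW D20); nra.
by rewrite ltNge; move: key; rewrite (pmulr_rle0 _ (mulr_gt0 t0 D20)) => ->.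
Qed.

Let sq_le_expR (c x : R) : 0 < c -> x ^+ 2 <= c^-1 * expR (c * x ^+ 2).
Proof.
move=> c0; rewrite ler_pdivlMl//; apply: le_trans (expR_ge1Dx _).
by rewrite lerDr.
Qed.

Let msq : measurable_fun setT (fun w => (Y w - m) ^+ 2).
Proof. by apply: measurable_funX; exact: measurable_funB. Qed.

Let mgauss (c : R) : measurable_fun setT (fun w => expR (c * (Y w - m) ^+ 2)).
Proof. by apply: measurableT_comp => //; exact: measurable_funM. Qed.

Let integrable_gauss (r : R) : s != 0 -> 0 < r -> P.-integrable setT
  (fun w => (expR (- ((1 / r ^+ 2 - 1) / (2 * s ^+ 2)) * (Y w - m) ^+ 2))%:E).
Proof.
move=> s0 r0; apply/integrableP; split; first exact/measurable_EFinP.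
under eq_integral do rewrite /= ger0_norm ?expR_ge0//.
by rewrite (gauss_transform_is_normal mY nY s0 r0) ltry.
Qed.

Lemma integrable_sq_is_normal :
  P.-integrable setT (fun w => ((Y w - m) ^+ 2)%:E).
Proof.
have [s0|s0] := eqVneq s 0.
  apply/integrableP; split; first exact/measurable_EFinP.
  under eq_integral do rewrite /= ger0_norm ?sqr_ge0//.
  rewrite (ge0_integral_is_normal0 (m := m) (f := fun y => (y - m) ^+ 2) mY)//.
  - exact: ltry.
  - by rewrite -s0.
  - by apply: measurable_funX; exact: measurable_funB.
  - by move=> y; exact: sqr_ge0.
have s20 : 0 < s ^+ 2 by rewrite exprn_even_gt0.
(* The case [r = 2] of the Gaussian transform: [c = 3 / (8 s^2)] is positive, so the integrable
   function [expR (c * (Y - m) ^+ 2)] dominates the square. *)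
pose c := - ((1 / 2 ^+ 2 - 1) / (2 * s ^+ 2)).
have c0 : 0 < c.
  rewrite /c -mulNr divr_gt0//; last by rewrite mulr_gt0.
  by lra.
have := integrableZl measurableT c^-1 (integrable_gauss s0 (ltr0Sn _ 1)).
apply: le_integrable => //; first exact/measurable_EFinP.
move=> w _; rewrite /= lee_fin (ger0_norm (sqr_ge0 _)).
by apply: le_trans (ler_norm _); exact: sq_le_expR.
Qed.

(** Integrates [1 - x <= expR (- x)] with [x] the exponent of the Gaussian transform, whose integral
    is [r]. The sign of [1 / r ^+ 2 - 1] is free, which yields bounds on both sides. *)
Let sq_bound (r : R) : s != 0 -> 0 < r ->
  1 - (1 / r ^+ 2 - 1) / (2 * s ^+ 2) *
        fine (\int[P]_w ((Y w - m) ^+ 2)%:E)%E <= r.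
Proof.
move=> s0 r0; set c := _ / _.
have iq := integrable_sq_is_normal.
rewrite -lee_fin -(gauss_transform_is_normal mY nY s0 r0) -/c.
apply: (@le_trans _ _ (\int[P]_w (1 - c * (Y w - m) ^+ 2)%:E)%E).
  under [leRHS]eq_integral => w _ do rewrite EFinB EFinM.
  rewrite integralB//=; [|exact: finite_measure_integrable_cst|exact: integrableZl].
  rewrite integral_cst//= [X in (_ * X)%E]probability_setT mule1 integralZl//.
  by rewrite -[in leRHS](fineK (integrable_fin_num measurableT iq)) -EFinM -EFinB.
apply: le_integral => //.
- have -> : (fun w => (1 - c * (Y w - m) ^+ 2)%:E) =
      (cst 1%:E \- (fun w => c%:E * ((Y w - m) ^+ 2)%:E))%E.
    by apply/funext => w; rewrite EFinB EFinM.
  apply: integrableB => //; last exact: integrableZl.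
  exact: finite_measure_integrable_cst.
- exact: integrable_gauss.
- by move=> w _; rewrite lee_fin mulNr; exact: expR_ge1Dx.
Qed.

(** By [sq_bound], [(1 + r) * V] is at least [2 * s ^+ 2 * r ^+ 2] for [r < 1] and at most that for
    [r > 1]; letting [r] tend to 1 gives [V = s ^+ 2]. *)
Lemma integral_sq_is_normal :
  (\int[P]_w ((Y w - m) ^+ 2)%:E = (s ^+ 2)%:E)%E.
Proof.
have [s0|s0] := eqVneq s 0.
  rewrite (ge0_integral_is_normal0 (m := m) (f := fun y => (y - m) ^+ 2) mY)//.
  - by rewrite subrr s0.
  - by rewrite -s0.
  - by apply: measurable_funX; exact: measurable_funB.
  - by move=> y; exact: sqr_ge0.
have iq := integrable_sq_is_normal.
have s20 : 0 < s ^+ 2 by rewrite exprn_even_gt0.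
have VE := fineK (integrable_fin_num measurableT iq).
set V := fine _ in VE; rewrite -VE; congr EFin.
have V0 : 0 <= V by apply: fine_ge0; apply: integral_ge0 => w _; rewrite lee_fin sqr_ge0.
have bnd r : 0 < r -> (1 - r) * (2 * s ^+ 2 * r ^+ 2) <= (1 - r) * ((1 + r) * V).
  move=> r0; have := sq_bound s0 r0; rewrite -/V => h.
  have r20 : 0 < r ^+ 2 by rewrite exprn_gt0.
  have -> : (1 - r) * ((1 + r) * V) =
     (1 / r ^+ 2 - 1) / (2 * s ^+ 2) * V * (2 * s ^+ 2 * r ^+ 2).
    by field; rewrite s0 gt_eqF.
  have w0 : 0 < 2 * s ^+ 2 * r ^+ 2 by rewrite mulr_gt0// mulr_gt0.
  rewrite (ler_pM2r w0).
  by move: h; rewrite lerBlDl -lerBlDr.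
apply/eqP; rewrite eq_le; apply/andP; split; apply/ler_addgt0Pr => e e0.
(* The limit is made explicit with [r = 1 + t] and [r = 1 - t], where [t = e / (3 s^2 + e)] is small
   enough to keep the error below [e]. *)
all: have w0 : 0 < 3 * s ^+ 2 + e by lra.
all: have t0 : 0 < e / (3 * s ^+ 2 + e) by rewrite divr_gt0.
all: have ts : e / (3 * s ^+ 2 + e) * (3 * s ^+ 2 + e) = e by rewrite divfK// gt_eqF.
all: move: (e / _) t0 ts => t t0 ts.
all: have t1 : t < 1 by rewrite -(ltr_pM2r w0) ts mul1r; lra.
all: have ts3 : 3 * (t * s ^+ 2) <= e by have := mulr_gt0 t0 e0; lra.
all: have ts0 : 0 < t * s ^+ 2 by rewrite mulr_gt0.
all: have tts : t * (t * s ^+ 2) <= t * s ^+ 2 by rewrite ler_piMl// ltW.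
- have tV : 0 <= t * V by rewrite mulr_ge0// ltW.
  have t'0 : 0 < 1 + t by lra.
  have := bnd _ t'0; rewrite (_ : 1 - (1 + t) = - t); last by ring.
  rewrite !mulNr lerN2 ler_pM2l// => h.
  by nra.
- have tV : 0 <= t * V by rewrite mulr_ge0// ltW.
  have t'0 : 0 < 1 - t by lra.
  have := bnd _ t'0; rewrite (_ : 1 - (1 - t) = t); last by ring.
  rewrite ler_pM2l// => h.
  by nra.
Qed.

End normal_moments.

(** * Linear combinations of equicorrelated normal variables *)

Section equicorrelated.
Context {R : realType} {d : measure_display} {Omega : measurableType d}
  (P : probability Omega R) (n : nat) (rho : R) (mu : 'I_n -> R)
  (X : 'I_n -> {RV P >-> R}).
Hypotheses (X_joint : jointly_normal X)
  (X_marginal : forall i, is_normal P (X i) (mu i) 1)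
  (X_corr : forall i j, i != j -> correlation (X i) (X j) = rho).

Let mX i : measurable_fun setT (X i).
Proof. exact: measurable_funPT. Qed.

Let U i w := X i w - mu i.

Let mU i : measurable_fun setT (U i).
Proof. exact: measurable_funB. Qed.

Let integrable_UU i j : P.-integrable setT (fun w => (U i w * U j w)%:E).
Proof.
have := integrableD measurableT (integrable_sq_is_normal (mX i) (X_marginal i))
  (integrable_sq_is_normal (mX j) (X_marginal j)).
apply: le_integrable => //; first exact/measurable_EFinP/measurable_funM.
move=> w _; rewrite /= lee_fin -/(U i w) -/(U j w); apply: le_trans (ler_norm _).
by rewrite ler_norml; apply/andP; split; nra.
Qed.

Let covarianceUU i j : (covariance P (X i) (X j) = \int[P]_w (U i w * U j w)%:E)%E.
Proof.
rewrite [in LHS]unlock (expectation_is_normal (mX i) (X_marginal i)).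
by rewrite (expectation_is_normal (mX j) (X_marginal j)) unlock.
Qed.

Let varianceX i : (variance P (X i) = 1)%E.
Proof.
rewrite /variance covarianceUU -(expr1n R 2).
rewrite -(integral_sq_is_normal (mX i) (X_marginal i)).
by apply: eq_integral => w _; rewrite expr2.
Qed.

Let integral_UU i j :
  (\int[P]_w (U i w * U j w)%:E = (if i == j then 1 else rho)%:E)%E.
Proof.
have [<-|ij] := eqVneq i j; first by rewrite -covarianceUU; exact: varianceX.
rewrite -(X_corr ij) /correlation !varianceX /= sqrtr1 mulr1 divr1.
by rewrite covarianceUU fineK// integrable_fin_num.
Qed.

Lemma measurable_lincomb (a : 'I_n -> R) :
  measurable_fun setT (fun w => \sum_(i < n) a i * X i w).
Proof. by apply: measurable_sum => i; exact: measurable_funM. Qed.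

(** [X_joint] supplies an unspecified mean and deviation; the first two moments identify them. The
    covariance matrix is rho J + (1 - rho) I, with J the all-ones matrix. *)
Lemma lincomb_is_normal (a : 'I_n -> R) : exists s : R,
  [/\ 0 <= s,
      s ^+ 2 = rho * (\sum_i a i) ^+ 2 + (1 - rho) * \sum_i a i ^+ 2 &
      is_normal P (fun w => \sum_(i < n) a i * X i w) (\sum_i a i * mu i) s].
Proof.
have [m [s [s0 nY]]] := X_joint a; have mY := measurable_lincomb a.
have iX i := integrable_is_normal (mX i) (X_marginal i).
have mE : m = \sum_i a i * mu i.
  apply/EFin_inj; rewrite -(expectation_is_normal mY nY) unlock.
  under eq_integral => w _ do rewrite -sumEFin.
  rewrite integral_sum//; last first.
    by move=> i; under eq_fun do rewrite EFinM; exact: (integrableZl measurableT (a i) (iX i)).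
  rewrite -sumEFin; apply: eq_bigr => i _.
  under eq_integral do rewrite EFinM.
  rewrite integralZl//; last exact: iX.
  rewrite EFinM; congr (_ * _)%E.
  by rewrite -(expectation_is_normal (mX i) (X_marginal i)) unlock.
exists s; rewrite -mE; split => //.
apply/EFin_inj; rewrite -(integral_sq_is_normal mY nY) mE.
have YE w : (\sum_i a i * X i w - \sum_i a i * mu i) ^+ 2 =
            \sum_i \sum_j a i * a j * (U i w * U j w).
  rewrite -sumrB expr2 big_distrl/=; apply: eq_bigr => i _.
  rewrite big_distrr/=; apply: eq_bigr => j _.
  by rewrite /U; ring.
under eq_integral do rewrite YE -sumEFin.
have iaU i j : P.-integrable setT (fun w => (a i * a j * (U i w * U j w))%:E).
  by under eq_fun do rewrite EFinM; exact: (integrableZl measurableT _ (integrable_UU i j)).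
rewrite integral_sum//; last first.
  move=> i; under eq_fun do rewrite -sumEFin.
  by apply: integrable_sum => // j _; exact: iaU.
transitivity (\sum_i (\sum_j a i * a j * (if i == j then 1 else rho))%:E)%E.
  apply: eq_bigr => i _; under eq_integral do rewrite -sumEFin.
  rewrite integral_sum// -sumEFin; apply: eq_bigr => j _.
  under eq_integral do rewrite EFinM.
  by rewrite integralZl ?integral_UU.
rewrite sumEFin; congr EFin.
have aE i : \sum_j a i * a j * (if i == j then 1 else rho) =
            rho * (a i * \sum_j a j) + (1 - rho) * a i ^+ 2.
  rewrite (bigD1 i)//= eqxx [in RHS](bigD1 i)//=.
  rewrite (eq_bigr (fun j => rho * a i * a j)); last first.
    by move=> j ji; rewrite eq_sym (negbTE ji); ring.
  by rewrite -big_distrr/=; ring.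
under eq_bigr do rewrite aE.
by rewrite big_split/= -!big_distrr/= -big_distrl/= expr2.
Qed.

End equicorrelated.

(** * Tail estimates for normal laws *)

(** The sign of [l] is free: [l = 1] serves for the upper tail and [l = -1] for the lower tail. *)
Lemma chernoff_is_normal {R : realType} {d : measure_display}
  {Omega : measurableType d} (P : probability Omega R) (Y : Omega -> R)
  (m s l t : R) :
  measurable_fun setT Y -> is_normal P Y m s ->
  (P [set w | t <= l * Y w]%R <= (expR (- t + l * m + l ^+ 2 * s ^+ 2 / 2))%:E)%E.
Proof.
move=> mY nY.
have mlY : measurable_fun setT (fun w => l * Y w) by exact: measurable_funM.
pose Z : {RV P >-> R} := HB.pack (fun w => l * Y w) (isMeasurableFun.Build _ _ _ _ _ mlY).
have /= := chernoff Z t ltr01; rewrite /mmt_gen_fun unlock /=.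
under eq_integral do rewrite mulr1.
rewrite (mgf_is_normal _ mY nY) -EFinM -expRD mul1r.
by congr (_ <= (expR _)%:E)%E; ring.
Qed.

Section normal_tails.
Context {R : realType}.
Notation lambda := (@lebesgue_measure R).
Implicit Types (K s x y eps eta : R).

Local Notation N01 := (normal_prob (0 : R) 1).

Let N01T : (N01 setT = 1)%E. Proof. exact: probability_setT. Qed.

Let Phi_fin x : (Phi x)%:E = (N01 `]-oo, x])%E.
Proof. by rewrite /Phi fineK// fin_num_measure. Qed.

Lemma Phi_nondecreasing : {homo (@Phi R) : x y / x <= y}.
Proof.
move=> x y xy; rewrite -lee_fin !Phi_fin; apply: le_measure; rewrite ?inE//.
exact: subset_itvl.
Qed.

Lemma measurable_Phi : measurable_fun setT (@Phi R).
Proof. by apply: nondecreasing_measurable => // x y; exact: Phi_nondecreasing. Qed.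

Let onem_Phi x : ((1 - Phi x)%:E = N01 `]x, +oo[)%E.
Proof.
have E : (N01 `]-oo, x] + N01 `]x, +oo[ = 1)%E.
  rewrite -measureU//= -?eq_opE; last exact: disjoint_rays.
  by rewrite itv_setU_setT; apply/eqP; exact: N01T.
by rewrite EFinB Phi_fin -E addeAC subee ?add0e// fin_num_measure.
Qed.

Let N01_itv_ub x y : x <= y -> (N01 `[x, y] <= (normal_peak 1 * (y - x))%:E)%E.
Proof.
move=> xy; rewrite /normal_prob.
apply: (@le_trans _ _ (\int[lambda]_(z in `[x, y]) (normal_peak 1)%:E)%E).
  apply: ge0_le_integral => //.
  - by move=> z _; rewrite lee_fin normal_pdf_ge0.
  - by apply/measurable_EFinP/measurable_funTS; exact: measurable_normal_pdf.
  - by move=> z _; rewrite lee_fin normal_pdf_ub.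
rewrite integral_cst//= lebesgue_measure_itv/= lte_fin.
case: ifPn => _; first by rewrite -EFinB -EFinM.
by rewrite mule0 lee_fin mulr_ge0 ?normal_peak_ge0 ?subr_ge0.
Qed.

(** On []x, x + 1]] the density is at least its value [c] at [|x| + 1], so this interval alone has
    positive mass. *)
Lemma Phi_lt1 x : Phi x < 1.
Proof.
rewrite -subr_gt0 -lte_fin onem_Phi /normal_prob.
pose c := normal_peak 1 * expR (- (`|x| + 1) ^+ 2 / 2).
have c0 : 0 < c by rewrite mulr_gt0 ?expR_gt0// normal_peak_gt0// oner_eq0.
apply: (@lt_le_trans _ _ (\int[lambda]_(z in `]x, (x + 1)%R]) c%:E)%E).
  rewrite integral_cst//= lebesgue_measure_itv/= lte_fin ltrDl ltr01.
  by rewrite -EFinB -EFinM lte_fin mulr_gt0//; lra.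
apply: (@le_trans _ _ (\int[lambda]_(z in `]x, (x + 1)%R]) (normal_pdf 0 1 z)%:E)%E).
  apply: ge0_le_integral => //.
  - by move=> z _; rewrite lee_fin ltW.
  - by apply/measurable_EFinP/measurable_funTS; exact: measurable_normal_pdf.
  - move=> z /=; rewrite in_itv/= => /andP[xz zx].
    rewrite lee_fin normal_pdfE ?oner_eq0// /normal_fun ler_pM2l ?normal_peak_gt0 ?oner_eq0//.
    rewrite ler_expR subr0 expr1n !mulNr lerN2 ler_pM2r ?invr_gt0//.
    have zx1 : `|z| <= `|x| + 1.
      have := ler_norm x; have := ler_norm (- x); rewrite normrN => h1 h2.
      by rewrite ler_norml; apply/andP; split; lra.
    rewrite -[leLHS]real_normK ?num_real// lerXn2r//.
    by rewrite nnegrE addr_ge0.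
apply: ge0_subset_integral => //.
- by apply/measurable_EFinP/measurable_funTS; exact: measurable_normal_pdf.
- by move=> z _; rewrite lee_fin normal_pdf_ge0.
- exact: subset_itvl.
Qed.

Lemma Phi_to0 eps : 0 < eps -> exists x, Phi x < eps.
Proof.
(* The term [2^-1] cancels the variance term of the Chernoff bound, leaving [expR (- eps^-1)], which
   is less than [eps]. *)
move=> e0; exists (- (2^-1 + eps^-1)).
rewrite -lte_fin Phi_fin.
pose idR : measurableTypeR R -> R := idfun.
have midR : measurable_fun setT idR by exact: measurable_id.
have nid : is_normal (N01 : probability (measurableTypeR R) R) idR 0 1.
  by move=> A mA; rewrite oner_eq0.
have := chernoff_is_normal (-1) (2^-1 + eps^-1) midR nid.
set B := [set w | _] => h.
have BE : B = `]-oo, (- (2^-1 + eps^-1))]%classic.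
  by apply/seteqP; split=> w; rewrite /B /= in_itv/= mulN1r lerNr.
rewrite -BE; apply: le_lt_trans h _.
rewrite lte_fin (_ : - _ + _ + _ = - eps^-1); last by field; rewrite gt_eqF.
rewrite expRN invf_plt ?posrE ?expR_gt0//.
by apply: lt_le_trans (expR_ge1Dx _); rewrite ltrDr.
Qed.

(** Super-uniformity of a null p-value. A point [x] of [A] close to [inf A] replaces a quantile: [A]
    is covered by []x, +oo[], of mass [1 - Phi x <= eps], and [[inf A, x]], of small mass because
    the density is bounded. *)
Lemma normal_prob_onem_Phi_le eps : 0 < eps ->
  (N01 [set x | 1 - Phi x <= eps]%R <= eps%:E)%E.
Proof.
move=> e0; set A := [set x | _].
have mA : measurable A.
  by apply: measurable_sublevel; apply: measurable_funB => //; exact: measurable_Phi.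
have [e1|e1] := leP 1 eps.
  by apply: (@le_trans _ _ 1%E); [exact: probability_le1|rewrite lee_fin].
have [->|/set0P[a0 Aa0]] := eqVneq A set0; first by rewrite measure0 lee_fin ltW.
have [b Phib] : exists b, Phi b < 1 - eps by apply: Phi_to0; lra.
have lbA : lbound A b.
  move=> x Ax; rewrite leNgt; apply/negP => xb.
  have := Phi_nondecreasing (ltW xb); move: Ax; rewrite /A /=; lra.
have infA : has_inf A by split; [exists a0|exists b].
apply/lee_addgt0Pr => e' e'0.
have L0 : 0 < normal_peak (1 : R) by rewrite normal_peak_gt0// oner_eq0.
have [x Ax xt] := inf_adherent (divr_gt0 e'0 L0) infA.
have tx : inf A <= x by apply: ge_inf => //; exists b.
apply: (@le_trans _ _ (N01 (`[inf A, x] `|` `]x, +oo[)%classic)).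
  apply: le_measure; rewrite ?inE//; first exact: measurableU.
  move=> y Ay /=; rewrite !in_itv/= andbT.
  by have [yx|xy] := leP y x; [left; rewrite ge_inf//; exists b|right].
apply: (le_trans (measureU2 _ _ _)) => //.
rewrite addeC; apply: leeD.
  by apply: (@le_trans _ _ (1 - Phi x)%:E); rewrite ?onem_Phi// -onem_Phi lee_fin.
apply: (le_trans (N01_itv_ub tx)).
by rewrite lee_fin mulrC -ler_pdivlMr// ltW// ltrBlDl.
Qed.

End normal_tails.

(** * Comparison of the upper tail of N(m, s^2), s < 1, with that of N(0, 1) *)

Section tail_comparison.
Context {R : realType}.
Notation lambda := (@lebesgue_measure R).
Implicit Types (K s x y eps eta : R).

(** The worst exponent is that of [m = K], [s = s0]; its gap [q] to the exponent of N(0, 1) grows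
    like [g * y ^+ 2 / 2], and [g > 0] because [s0 < 1]. *)
Lemma normal_pdf_dominated K s0 eta :
  0 <= K -> 0 < s0 < 1 -> 0 < eta ->
  exists x0, forall m s y, m <= K -> 0 < s ->
    s0 ^+ 2 / 2 <= s ^+ 2 <= s0 ^+ 2 -> x0 <= y ->
    normal_pdf m s y <= eta * normal_pdf 0 1 y.
Proof.
move=> K0 /andP[s00 s01] eta0.
have s20 : 0 < s0 ^+ 2 by rewrite exprn_gt0.
have s21 : s0 ^+ 2 < 1 by rewrite expr_lt1// ltW.
pose g := (s0 ^+ 2)^-1 - 1.
have g0 : 0 < g by rewrite subr_gt0 invf_gt1.
(* [L] bounds [1 / (s * eta)] because [s >= s0 / 2]; hence [expR q >= L] suffices, and [x0] is
   chosen to give [q >= L]. *)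
pose L := 2 / (s0 * eta).
have L0 : 0 < L by rewrite divr_gt0// mulr_gt0.
pose x0 := 1 + K + (2 * K / s0 ^+ 2 + 2 * L) / g.
exists x0 => m s y mK spos /andP[s2l s2u] x0y.
have Ks0 : 0 <= 2 * K / s0 ^+ 2 by rewrite divr_ge0 ?mulr_ge0// ltW.
have frac0 : 0 <= (2 * K / s0 ^+ 2 + 2 * L) / g.
  by rewrite divr_ge0 ?(ltW g0)// addr_ge0// mulr_ge0// ltW.
have y1 : 1 <= y.
  by apply: le_trans x0y; rewrite /x0 -addrA lerDl addr_ge0.
have yK : K <= y.
  by apply: le_trans x0y; rewrite /x0 (addrC 1) -addrA lerDl addr_ge0.
have gy : 2 * K / s0 ^+ 2 + 2 * L <= g * y.
  rewrite [leRHS]mulrC -ler_pdivrMr//; apply: le_trans x0y.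
  by rewrite /x0 lerDr addr_ge0.
have ss0 : s0 / 2 <= s.
  rewrite leNgt; apply/negP => h.
  have h' : 0 < s0 / 2 + s by lra.
  have : 0 < (s0 / 2 - s) * (s0 / 2 + s) by rewrite mulr_gt0// subr_gt0.
  by move: s2l s20; lra.
have s_neq0 : s != 0 by rewrite gt_eqF.
rewrite !normal_pdfE ?oner_eq0//.
have -> : normal_peak s = s^-1 * normal_peak 1.
  rewrite /normal_peak (_ : s ^+ 2 * pi *+ 2 = s ^+ 2 * (1 ^+ 2 * pi *+ 2)); last by ring.
  by rewrite sqrtrM ?sqr_ge0// sqrtr_sqr gtr0_norm// invfM.
rewrite -mulrA mulrCA [leRHS]mulrCA ler_pM2l ?normal_peak_gt0 ?oner_eq0//.
rewrite /normal_fun subr0 expr1n.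
pose q := (y - K) ^+ 2 / (s0 ^+ 2 *+ 2) - y ^+ 2 / 2.
have qL : L <= q.
  have -> : q = (g * y * y - 2 * K / s0 ^+ 2 * y + K ^+ 2 / s0 ^+ 2) / 2.
    by rewrite /q /g; field; rewrite gt_eqF.
  have K2 : 0 <= K ^+ 2 / s0 ^+ 2 by rewrite divr_ge0 ?sqr_ge0.
  have : 0 <= (g * y - (2 * K / s0 ^+ 2 + 2 * L)) * y by rewrite mulr_ge0//; lra.
  have : L <= L * y by rewrite ler_peMr// ltW.
  rewrite ler_pdivlMr// mulrBl mulrDl; lra.
have h1 : expR (- (y - m) ^+ 2 / (s ^+ 2 *+ 2)) <= expR (- q + - y ^+ 2 / 2).
  have -> : - q + - y ^+ 2 / 2 = - ((y - K) ^+ 2 / (s0 ^+ 2 *+ 2)).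
    by rewrite /q; field; rewrite gt_eqF.
  rewrite ler_expR mulNr lerN2.
  apply: ler_pM; rewrite ?sqr_ge0 ?invr_ge0 ?mulrn_wge0 ?sqr_ge0//.
    by rewrite ler_sqr ?nnegrE ?subr_ge0// ?lerD2l ?lerN2// (le_trans mK).
  by rewrite lef_pV2 ?posrE ?pmulrn_lgt0 ?exprn_gt0// lerMn2r.
apply: le_trans (ler_wpM2l _ h1) _; first by rewrite invr_ge0 ltW.
rewrite expRD mulrA ler_wpM2r ?expR_ge0// expRN.
have eq0 := expR_gt0 q.
rewrite ler_pdivrMr// -ler_pdivrMl//.
apply: (@le_trans _ _ L).
  have -> : L = eta^-1 * (s0 / 2)^-1 by rewrite /L; field; rewrite !gt_eqF.
  by rewrite ler_pM2l ?invr_gt0// lef_pV2 ?posrE// divr_gt0.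
by apply: le_trans qL _; apply: le_trans (expR_ge1Dx _); rewrite lerDr.
Qed.

Lemma normal_upper_tail K s0 eta :
  0 <= K -> 0 < s0 < 1 -> 0 < eta ->
  exists2 eps0, 0 < eps0 & forall eps, 0 < eps <= eps0 ->
    forall m s (d : measure_display) (Omega : measurableType d)
      (P : probability Omega R) (Y : Omega -> R),
    measurable_fun setT Y -> is_normal P Y m s -> m <= K -> 0 < s ->
    s0 ^+ 2 / 2 <= s ^+ 2 <= s0 ^+ 2 ->
    (P [set w | 1 - Phi (Y w) <= eps]%R <= (eta * eps)%:E)%E.
Proof.
move=> K0 s01 eta0; have [x0 dom] := normal_pdf_dominated K0 s01 eta0.
have := Phi_lt1 x0; rewrite -subr_gt0 => e0.
(* Halving makes [eps] strictly smaller than [1 - Phi x0], so the event forces [Y] into the region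
   where the densities are compared. *)
exists ((1 - Phi x0) / 2); first by rewrite divr_gt0.
move=> eps /andP[eps0 epsle] m s d Omega P Y mY nY mK spos ss0.
set A := [set x | 1 - Phi x <= eps].
have mA : measurable A.
  by apply: measurable_sublevel; apply: measurable_funB => //; exact: measurable_Phi.
have A0 x : A x -> x0 <= x.
  move=> Ax; rewrite leNgt; apply/negP => xx0.
  by have := Phi_nondecreasing (ltW xx0); move: Ax; rewrite /A /=; lra.
have -> : P [set w | 1 - Phi (Y w) <= eps] = normal_prob m s A.
  by have := nY A mA; rewrite gt_eqF.
have mpdf m' s' : measurable_fun A (fun x => (normal_pdf m' s' x)%:E).
  by apply/measurable_EFinP/measurable_funTS; exact: measurable_normal_pdf.
apply: (@le_trans _ _ (\int[lambda]_(x in A) (eta%:E * (normal_pdf 0 1 x)%:E))%E).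
  apply: ge0_le_integral => //.
  - by move=> x _; rewrite lee_fin normal_pdf_ge0.
  - exact: mpdf.
  - exact: (measurable_funeM eta%:E (mpdf 0 1)).
  - by move=> x /A0 x0x; rewrite -EFinM lee_fin dom.
have -> : (\int[lambda]_(x in A) (eta%:E * (normal_pdf 0 1 x)%:E) =
           eta%:E * normal_prob 0 1 A)%E.
  apply: ge0_integralZl_EFin => //; last exact: ltW.
    by move=> x _; rewrite lee_fin normal_pdf_ge0.
  exact: mpdf.
rewrite EFinM lee_pmul2l//.
exact: normal_prob_onem_Phi_le.
Qed.

End tail_comparison.

(** * Order statistics, Hommel's procedure, and sets cut out by finitely many events *)

(** In a sorted sequence the entries at most [c] form a prefix; this turns order statistics into
    counts. *)
Lemma nth_sorted_le {R : realType} (s : seq R) (c : R) (i : nat) :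
  sorted <=%R s -> (i < size s)%N ->
  (nth 0 s i <= c) = (i < count (fun x => (x <= c)%R) s)%N.
Proof.
elim: s i => [//|x s IHs] i /= xs.
have [xc|cx] := leP x c; last first.
  have gtc y : y \in x :: s -> (y <= c) = false.
    rewrite inE => /predU1P[->|ys]; first by rewrite leNgt cx.
    move: xs; rewrite (path_sortedE le_trans) => /andP[/allP /(_ _ ys) xy _].
    by rewrite leNgt (lt_le_trans cx xy).
  move=> i_lt; rewrite (gtc (nth 0 (x :: s) i)); last exact: mem_nth.
  rewrite (eq_in_count (a2 := pred0)) ?count_pred0// => y ys.
  by apply: gtc; rewrite inE ys orbT.
case: i => [|i] //= i_lt; rewrite IHs//; exact: path_sorted xs.
Qed.

Section hommel.
Context {R : realType}.
Implicit Types (alpha c : R) (n : nat).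

Lemma ordered_pvalue_gt n (p : 'I_n -> R) c (k : nat) : (0 < k <= n)%N ->
  (c < ordered_pvalue p k) = (#|[set l | (p l <= c)%R]%SET| < k)%N.
Proof.
move=> /andP[k0 kn]; rewrite ltNge /ordered_pvalue nth_sorted_le.
- rewrite -leqNgt -ltnS prednK// (permP (permEl (perm_sort _ _))) count_map.
  rewrite cardE size_filter -enumT; congr (_ < _)%N.
  by apply: eq_count => l; rewrite /= inE.
- exact: (sort_sorted (@le_total _ R)).
- by rewrite size_sort size_map size_enum_ord prednK.
Qed.

(* The number [N] of p-values above [alpha] is itself admissible in Step 1. *)
Lemma hommel_reject_le n (p : 'I_n -> R) alpha (i : 'I_n) :
  0 < alpha -> (0 < #|[set l | (alpha < p l)%R]%SET|)%N ->
  i \in hommel alpha p -> p i <= alpha / #|[set l | (alpha < p l)%R]%SET|%:R.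
Proof.
move=> alpha0; set N := #|_| => N0.
have Nn : (N <= n)%N by rewrite -[n in (_ <= n)%N]card_ord max_card.
have adm : hommel_admissible alpha p N.
  rewrite /hommel_admissible N0 Nn/=; apply/allP => k.
  rewrite mem_iota add1n ltnS => /andP[k1 kN].
  have alpha_k : k%:R * alpha / N%:R <= alpha.
    rewrite ler_pdivrMr ?ltr0n// mulrC ler_pM2l// ler_nat//.
  (* Exactly [n - N] p-values are at most [alpha], so the one of rank [n - N + k] with [k >= 1]
     exceeds it. *)
  apply: le_lt_trans alpha_k _; rewrite ordered_pvalue_gt; last first.
    by rewrite ltn_addl//= -leq_subRL ?leq_subr// subKn.
  have -> : [set l | p l <= alpha]%SET = (~: [set l | alpha < p l])%SET.
    by apply/setP => l; rewrite !inE leNgt.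
  by rewrite cardsCs finset.setCK card_ord -addn1 leq_add2l.
(* Admissibility of [N] rules out the branch that rejects everything, and gives [N <= j] in the
   other. *)
rewrite /hommel; case: ifPn => [_|]; last first.
  by move=> /existsPn /(_ (Ordinal (Nn : (N < n.+1)%N))); rewrite /= adm.
rewrite inE => /le_trans; apply.
set j := \max_(_ < _ | _) _.
have Nj : (N <= j)%N.
  exact: (leq_bigmax_cond (Ordinal (Nn : (N < n.+1)%N)) adm).
by rewrite ler_pM2l// lef_pV2 ?posrE ?ltr0n ?ler_nat// (leq_trans N0).
Qed.

(** The procedure sees the p-values only through finitely many threshold comparisons; this is what
    makes the error event measurable. *)
Lemma eq_hommel n (p p' : 'I_n -> R) alpha :
  (forall (k i : 'I_n.+1) l,
     (p l <= k%:R * alpha / i%:R) = (p' l <= k%:R * alpha / i%:R)) ->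
  hommel alpha p = hommel alpha p'.
Proof.
(* For [n = 0] the type ['I_n.+1] lacks the value [k = 1], needed at the end to recover the
   threshold [alpha / j]; there ['I_0] is empty. *)
case: n p p' => [|n] p p' pp'.
  by apply/setP => -[].
have adm i : hommel_admissible alpha p i = hommel_admissible alpha p' i.
  rewrite /hommel_admissible; case: (boolP (1 <= i <= n.+1)%N) => //= /andP[i1 ilen].
  apply: eq_in_all => k; rewrite mem_iota add1n ltnS => /andP[k1 ki].
  rewrite !ordered_pvalue_gt; try by rewrite ltn_addl//= -leq_subRL ?leq_subr// subKn.
  congr (_ < _)%N; apply: eq_card => l; rewrite !inE.
  have kn : (k < n.+2)%N by rewrite ltnS (leq_trans ki).
  have iln : (i < n.+2)%N by rewrite ltnS.
  exact: (pp' (Ordinal kn) (Ordinal iln) l).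
rewrite /hommel (eq_existsb (fun i : 'I_n.+2 => adm i)).
case: ifPn => // _.
rewrite (eq_bigl _ _ (fun i : 'I_n.+2 => adm i)).
set j := \max_(_ < _ | _) _.
have jn : (j < n.+2)%N by rewrite ltnS; apply/bigmax_leqP => i _; rewrite -ltnS.
apply/setP => l; rewrite !inE.
have := pp' (Ordinal (isT : (1 < n.+2)%N)) (Ordinal jn) l.
by rewrite /= mul1r.
Qed.

End hommel.

(* [E] is a union of cells of the finite partition generated by the [B i]. *)
Lemma measurable_saturated {d : measure_display} {T : measurableType d}
    (J : finType) (B : J -> set T) (E : set T) :
  (forall i, measurable (B i)) ->
  (forall x y, (forall i, B i x <-> B i y) -> E x -> E y) ->
  measurable E.
Proof.
move=> mB satE.
pose C (f : {ffun J -> bool}) : set T :=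
  \bigcap_(i in [set: J]) (if f i then B i else ~` B i).
have mC f : measurable (C f).
  apply: fin_bigcap_measurable; first exact: finite_finset.
  by move=> i _; case: (f i) => //; exact: measurableC.
pose g x : {ffun J -> bool} := [ffun i => `[< B i x >]].
have Cg x : C (g x) x.
  by move=> i _; rewrite ffunE; case: asboolP.
rewrite (_ : E = \bigcup_(f in g @` E) C f).
  by apply: fin_bigcup_measurable => //; exact: finite_finset.
apply/seteqP; split=> [x Ex|y [_ [x Ex <-]] Cy].
  by exists (g x); [exists x|exact: Cg].
apply: satE Ex => i; have := Cy i I; rewrite /g ffunE.
by case: asboolP.
Qed.

(** * Moment inequalities for sums and counts *)

Lemma markov_ge0 {R : realType} {d : measure_display} {T : measurableType d}
  (P : probability T R) (f : T -> R) (B C : R) :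
  measurable_fun setT f -> (forall w, 0 <= f w) -> 0 < B ->
  (\int[P]_w (f w)%:E <= C%:E)%E ->
  (P [set w | B <= f w]%R <= (C / B)%:E)%E.
Proof.
move=> mf f0 B0 fC.
have mE : measurable [set w | B <= f w] by exact: measurable_superlevel.
rewrite mulrC EFinM lee_pdivlMl//; apply: le_trans fC.
rewrite -integral_cst//.
apply: (@le_trans _ _ (\int[P]_(w in [set w | B <= f w]%R) (f w)%:E)%E).
  apply: ge0_le_integral => //.
  - by move=> w _; rewrite lee_fin ltW.
  - by apply/measurable_EFinP/measurable_funTS.
apply: ge0_subset_integral => //.
- exact/measurable_EFinP.
- by move=> w _; rewrite lee_fin.
Qed.

Lemma sum_lower_tail {R : realType} {d : measure_display} {T : measurableType d}
  (P : probability T R) (n : nat) (Z : 'I_n -> T -> R) (e : 'I_n -> R) (Q t : R) :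
  0 < t ->
  (forall l, measurable_fun setT (Z l)) ->
  (forall l, P.-integrable setT (EFin \o Z l)) ->
  (forall l k, P.-integrable setT (fun w => (Z l w * Z k w)%:E)) ->
  (forall l, (\int[P]_w (Z l w)%:E = (e l)%:E)%E) ->
  (forall l, (\int[P]_w (Z l w * Z l w)%:E <= Q%:E)%E) ->
  (forall l k, l != k -> (\int[P]_w (Z l w * Z k w)%:E <= (e l * e k)%:E)%E) ->
  (P [set w | \sum_l Z l w <= \sum_l e l - t]%R <= (n%:R * Q / t ^+ 2)%:E)%E.
Proof.
move=> t0 mZ iZ iZZ eZ Z2 Zlk.
pose S w := \sum_l (Z l w - e l).
have mS : measurable_fun setT S.
  by apply: measurable_sum => l; exact: measurable_funB.
have mS2 : measurable_fun setT (fun w => S w ^+ 2) by exact: measurable_funX.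
have sub : [set w | \sum_l Z l w <= \sum_l e l - t] `<=` [set w | t ^+ 2 <= S w ^+ 2].
  move=> w /=; rewrite /S sumrB -subr_ge0 => h.
  by rewrite -[leRHS]sqrrN ler_sqr ?nnegrE; lra.
apply: (@le_trans _ _ (P [set w | t ^+ 2 <= S w ^+ 2]%R)).
  apply: le_measure; rewrite ?inE//.
    by apply: measurable_sublevel; exact: measurable_sum.
  exact: measurable_superlevel.
apply: markov_ge0 => //; first by move=> w; exact: sqr_ge0.
  by rewrite exprn_gt0.
have SE w : S w ^+ 2 = \sum_l \sum_k (Z l w - e l) * (Z k w - e k).
  rewrite /S expr2 big_distrl/=; apply: eq_bigr => l _.
  by rewrite big_distrr.
have iW l k : P.-integrable setT (fun w => ((Z l w - e l) * (Z k w - e k))%:E).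
  have -> : (fun w => ((Z l w - e l) * (Z k w - e k))%:E) =
    ((((fun w => (Z l w * Z k w)%:E) \- (fun w => (e l)%:E * (Z k w)%:E))
     \- (fun w => (e k)%:E * (Z l w)%:E)) \+ cst (e l * e k)%:E)%E.
    by apply/funext => w /=; congr EFin; ring.
  apply: integrableD => //; last exact: finite_measure_integrable_cst.
  apply: integrableB => //; last exact: integrableZl (iZ l).
  apply: integrableB => //; exact: integrableZl (iZ k).
have intW l k : (\int[P]_w ((Z l w - e l) * (Z k w - e k))%:E =
    \int[P]_w (Z l w * Z k w)%:E - (e l * e k)%:E)%E.
  transitivity (\int[P]_w (((Z l w * Z k w)%:E - (e l)%:E * (Z k w)%:E)
     - ((e k)%:E * (Z l w)%:E + (- (e l * e k))%:E)))%E.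
    apply: eq_integral => w _.
    by rewrite /=; congr EFin; ring.
  have ilk := integrableZl measurableT (e l) (iZ k).
  have ikl := integrableZl measurableT (e k) (iZ l).
  have ic := finite_measure_integrable_cst P (- (e l * e k)) measurableT.
  have h1 a b : (\int[P]_w ((e a)%:E * (Z b w)%:E) = (e a * e b)%:E)%E.
    by rewrite integralZl// ?eZ//; exact: iZ.
  rewrite integralB//; [|exact: integrableB|exact: integrableD].
  rewrite integralB// integralD//.
  rewrite !h1 integral_cst//= [X in (_ * X)%E]probability_setT mule1.
  by rewrite -EFinD (mulrC (e k)) subrr sube0.
under eq_integral do rewrite SE -sumEFin.
rewrite integral_sum//; last first.
  move=> l; under eq_fun do rewrite -sumEFin.
  by apply: integrable_sum => // k _; exact: iW.
rewrite (_ : n%:R * Q = \sum_(l < n) Q); last first.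
  by rewrite sumr_const card_ord mulr_natl.
rewrite -sumEFin; apply: lee_sum => l _.
under eq_integral do rewrite -sumEFin.
rewrite integral_sum// (bigD1 l)//=.
rewrite -[leRHS]adde0; apply: leeD.
  rewrite intW; apply: le_trans (Z2 l).
  by rewrite leeBlDr// leeDl// lee_fin -expr2 sqr_ge0.
apply: sume_le0 => k kl; rewrite intW.
by rewrite sube_le0 Zlk// eq_sym.
Qed.

(** With [u = expR (- l * y i)]: if [y i > - a] then [u <= expR (l * a)]; otherwise
    [u <= dl * u ^+ 2 + 1 / (4 * dl)] by completing the square. Bounds on the two exponential sums
    thus force a lower bound on the count. *)
Lemma count_le_exp {R : realType} (n : nat) (y : 'I_n -> R) (l a dl : R) :
  0 <= l -> 0 < dl ->
  \sum_i expR (- l * y i) <= n%:R * expR (l * a) +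
    dl * \sum_i expR (- (2 * l) * y i) +
    #|[set i | (y i <= - a)%R]%SET|%:R / (4 * dl).
Proof.
move=> l0 dl0.
rewrite -sum1_card natr_sum mulr_suml (big_mkcond (fun i => i \in _))/= big_distrr/=.
have -> : n%:R * expR (l * a) = \sum_(i < n) expR (l * a).
  by rewrite sumr_const card_ord mulr_natl.
rewrite -!big_split/=; apply: ler_sum => i _.
have -> : expR (- (2 * l) * y i) = expR (- l * y i) ^+ 2.
  by rewrite expr2 -expRD; congr expR; ring.
have u0 := expR_gt0 (- l * y i); have v0 := expR_gt0 (l * a).
rewrite inE; case: ifPn => [_|]; last first.
  rewrite -ltNge => ya.
  have : expR (- l * y i) <= expR (l * a).
    by rewrite ler_expR mulNr -mulrN ler_wpM2l// lerNl ltW.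
  have : 0 <= dl * expR (- l * y i) ^+ 2 by rewrite mulr_ge0 ?sqr_ge0// ltW.
  by rewrite addr0; lra.
set u := expR _ in u0 *.
have -> : dl * u ^+ 2 = u - 1 / (4 * dl) + dl * (u - 1 / (2 * dl)) ^+ 2.
  by field; rewrite gt_eqF.
have : 0 <= dl * (u - 1 / (2 * dl)) ^+ 2 by rewrite mulr_ge0 ?sqr_ge0// ltW.
lra.
Qed.

(** * The sample mean and the residuals *)

Section centered.
Context {R : realType} {d : measure_display} {Omega : measurableType d}
  (P : probability Omega R) (n : nat) (rho M : R) (mu : 'I_n -> R)
  (X : 'I_n -> {RV P >-> R}).
Hypotheses (rho01 : 0 < rho < 1) (n2 : (2 <= n)%N)
  (mu0M : forall i, 0 <= mu i <= M)
  (X_joint : jointly_normal X)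
  (X_marginal : forall i, is_normal P (X i) (mu i) 1)
  (X_corr : forall i j, i != j -> correlation (X i) (X j) = rho).

Definition sample_mean (w : Omega) : R := n%:R^-1 * \sum_i X i w.

Let n0 : 0 < n%:R :> R. Proof. by rewrite ltr0n (leq_trans _ n2). Qed.
Let n_neq0 : n%:R != 0 :> R. Proof. by rewrite gt_eqF. Qed.
Let ge2n : 2 <= n%:R :> R. Proof. by rewrite (ler_nat R 2 n). Qed.

Let sum_cst (c : R) : \sum_(i < n) c = n%:R * c.
Proof. by rewrite sumr_const card_ord mulr_natl. Qed.

Let M0 : 0 <= M.
Proof.
have n00 : (0 < n)%N by apply: leq_trans n2.
by have /andP[] := mu0M (Ordinal n00); exact: le_trans.
Qed.

Let avg_mu : 0 <= n%:R^-1 * \sum_i mu i <= M.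
Proof.
apply/andP; split.
  by rewrite mulr_ge0 ?invr_ge0// ?ler0n// sumr_ge0// => i _; case/andP: (mu0M i).
rewrite ler_pdivrMl// -sum_cst; apply: ler_sum => i _.
by case/andP: (mu0M i).
Qed.

Lemma measurable_sample_mean : measurable_fun setT sample_mean.
Proof.
apply: measurable_funM => //; apply: measurable_sum => i.
exact: measurable_funPT.
Qed.

(** The mean of [sample_mean] is at most [M] and its variance rho + (1 - rho) / n at most 1, so
    Chernoff's bound does not depend on [n]. *)
Lemma sample_mean_upper_tail (K : R) :
  (P [set w | K <= sample_mean w]%R <= (expR (- K + M + 2^-1))%:E)%E.
Proof.
have [s [s0 s2 nY]] := lincomb_is_normal X_joint X_marginal X_corr (fun=> n%:R^-1).
have mE : (fun w => \sum_(i < n) n%:R^-1 * X i w) = sample_mean.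
  by apply/funext => w; rewrite /sample_mean mulr_sumr.
rewrite mE in nY.
have := chernoff_is_normal 1 K measurable_sample_mean nY.
rewrite (_ : [set w | K <= 1 * sample_mean w] = [set w | K <= sample_mean w]); last first.
  by apply/seteqP; split => w; rewrite /= mul1r.
move=> /le_trans; apply; rewrite lee_fin ler_expR mul1r expr1n mul1r.
rewrite -mulr_sumr -addrA -addrA lerD2l; apply: lerD.
  by case/andP: avg_mu.
have i0 : 0 < n%:R^-1 :> R by rewrite invr_gt0.
have i2 : n%:R^-1 <= 2^-1 :> R by rewrite lef_pV2 ?posrE.
have /andP[r0 r1] := rho01.
rewrite s2 !sum_cst mulfV ?n_neq0// expr1n mulr1 expr2 mulrA mulfV ?n_neq0// mul1r.
by nra.
Qed.

(** Row [l] of the centering matrix I - J / n. This matrix is a symmetric projection, which is why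
    [dev_dev] returns its own entries. *)
Let dev (l i : 'I_n) : R := (i == l)%:R - n%:R^-1.

Let sum_dev l : \sum_i dev l i = 0.
Proof.
rewrite /dev sumrB sum_cst mulfV// (bigD1 l)//= eqxx.
by rewrite big1 ?addr0 ?subrr// => i /negbTE ->.
Qed.

Let lin_dev l (z : 'I_n -> R) :
  \sum_i dev l i * z i = z l - n%:R^-1 * \sum_i z i.
Proof.
rewrite mulr_sumr /dev; under eq_bigr do rewrite mulrBl.
rewrite sumrB; congr (_ - _).
by rewrite (bigD1 l)//= eqxx mul1r big1 ?addr0// => i /negbTE ->; rewrite mul0r.
Qed.

Let dev_dev l k : \sum_i dev l i * dev k i = (l == k)%:R - n%:R^-1.
Proof. by rewrite lin_dev sum_dev mulr0 subr0. Qed.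

Definition residual (l : 'I_n) (w : Omega) : R := X l w - sample_mean w.

Lemma measurable_residual l : measurable_fun setT (residual l).
Proof.
apply: measurable_funB; last exact: measurable_sample_mean.
exact: measurable_funPT.
Qed.

Let mres l := mu l - n%:R^-1 * \sum_i mu i.

Let mres_bound l : - M <= mres l <= M.
Proof.
have /andP[h1 h2] := mu0M l; have /andP[h3 h4] := avg_mu.
by rewrite /mres; apply/andP; split; lra.
Qed.

(** The common variance of the residuals. *)
Let sg2 : R := (1 - rho) * (1 - n%:R^-1).

Let sg2_bound : (1 - rho) / 2 <= sg2 <= 1 - rho.
Proof.
have /andP[r0 r1] := rho01.
have i0 : 0 < n%:R^-1 :> R by rewrite invr_gt0.
have i2 : n%:R^-1 <= 2^-1 :> R by rewrite lef_pV2 ?posrE.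
by rewrite /sg2; apply/andP; split; nra.
Qed.

(** The coefficients sum to 0, which removes the [rho] term of the variance and leaves
    [th ^+ 2 * sg2]. *)
Lemma scaled_residual_is_normal (th : R) l : 0 < th -> exists m s : R,
  [/\ m <= th * M, 0 < s,
      th ^+ 2 * (1 - rho) / 2 <= s ^+ 2 <= th ^+ 2 * (1 - rho) &
      is_normal P (fun w => th * residual l w) m s].
Proof.
move=> th0.
have [s [s0 s2 nY]] := lincomb_is_normal X_joint X_marginal X_corr (fun i => th * dev l i).
have s2E : s ^+ 2 = th ^+ 2 * sg2.
  rewrite s2 -mulr_sumr sum_dev mulr0 expr0n/= mulr0 add0r.
  under eq_bigr do rewrite exprMn (expr2 (dev _ _)).
  by rewrite -mulr_sumr dev_dev eqxx /sg2/=; ring.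
have th20 : 0 < th ^+ 2 by rewrite exprn_gt0.
have /andP[sg2l sg2u] := sg2_bound.
have /andP[r0 r1] := rho01.
exists (\sum_i th * dev l i * mu i), s; split.
- under eq_bigr do rewrite -mulrA.
  rewrite -mulr_sumr lin_dev ler_pM2l//.
  by case/andP: (mres_bound l).
- rewrite lt_neqAle s0 andbT eq_sym -sqrf_eq0 s2E gt_eqF// mulr_gt0//.
  by apply: lt_le_trans sg2l; lra.
- rewrite s2E -(mulrA _ (1 - rho)); apply/andP; split.
    by rewrite (ler_pM2l th20).
  by rewrite (ler_pM2l th20).
- rewrite (_ : (fun w => _) = (fun w => \sum_i th * dev l i * X i w))//.
  apply/funext => w; under [RHS]eq_bigr do rewrite -mulrA.
  by rewrite -mulr_sumr lin_dev.
Qed.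

(** The product is the exponential of one linear combination, with coefficients [dev l + dev k]. For
    [l != k] the exponent carries the extra term - a^2 (1 - rho) / n, which makes the covariance of
    the exponentials nonpositive. *)
Let mgf_residual (a : R) (l k : 'I_n) :
  (\int[P]_w (expR (a * residual l w) * expR (a * residual k w))%:E =
   (expR (a * (mres l + mres k) +
     a ^+ 2 * (sg2 + (1 - rho) * ((l == k)%:R - n%:R^-1))))%:E)%E.
Proof.
have [s [s0 s2 nY]] := lincomb_is_normal X_joint X_marginal X_corr
  (fun i => dev l i + dev k i).
have YE (z : 'I_n -> R) : \sum_i (dev l i + dev k i) * z i =
    z l - n%:R^-1 * (\sum_i z i) + (z k - n%:R^-1 * \sum_i z i).
  by under eq_bigr do rewrite mulrDl; rewrite big_split/= !lin_dev.
transitivity (\int[P]_w (expR (a * \sum_i (dev l i + dev k i) * X i w))%:E)%E.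
  by apply: eq_integral => w _; rewrite -expRD YE -mulrDr.
rewrite (mgf_is_normal a (measurable_lincomb X _) nY) YE s2.
have -> : \sum_i (dev l i + dev k i) = 0 by rewrite big_split/= !sum_dev addr0.
have -> : \sum_i (dev l i + dev k i) ^+ 2 =
    \sum_i dev l i * dev l i + \sum_i dev k i * dev k i +
    2 * \sum_i dev l i * dev k i.
  rewrite mulr_sumr -!big_split/=; apply: eq_bigr => i _.
  by move: (dev l i) (dev k i) => x y; ring.
rewrite !dev_dev !eqxx /sg2 /mres/=.
move: (l == k)%:R (n%:R^-1 * _) => b c.
by congr (expR _)%:E; field.
Qed.

Let mgf1_residual (a : R) (l : 'I_n) :
  (\int[P]_w (expR (a * residual l w))%:E =
   (expR (a * mres l + a ^+ 2 * sg2 / 2))%:E)%E.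
Proof.
transitivity (\int[P]_w (expR (a / 2 * residual l w) * expR (a / 2 * residual l w))%:E)%E.
  by apply: eq_integral => w _; rewrite -expRD; congr (expR _)%:E; field.
rewrite mgf_residual eqxx; congr (expR _)%:E; rewrite /sg2/=; field.
exact: n_neq0.
Qed.

Let measurable_expR_residual (a : R) l :
  measurable_fun setT (fun w => expR (a * residual l w)).
Proof.
by apply: measurableT_comp => //; apply: measurable_funM => //; exact: measurable_residual.
Qed.

(* Since distinct residuals are negatively correlated, so are their exponentials;
   hence the empirical average of [expR (- l * residual)] concentrates at a value
   which, for [l] large, residuals above [- a] alone cannot produce. *)
Lemma residual_lower_count (l a eps : R) :
  0 < l -> 0 < eps ->
  2 * expR (l * a) + 2 <= expR (- (l * M) + l ^+ 2 * (1 - rho) / 4) ->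
  8 * expR (2 * l * M + 2 * l ^+ 2) / eps <= n%:R ->
  exists G : set Omega, [/\ measurable G, (P G <= eps%:E)%E &
    forall w, ~ G w ->
      n%:R * (eps / (2 * expR (2 * l * M + 2 * l ^+ 2))) <=
      #|[set i | (residual i w <= - a)%R]%SET|%:R].
Proof.
move=> l0 eps0 hl hn.
set Q := expR _ in hn *; set E0 := expR (- _ + _) in hl.
have Q0 : 0 < Q by exact: expR_gt0.
have /andP[r0 r1] := rho01; have /andP[sg2l sg2u] := sg2_bound.
have l20 : 0 < l ^+ 2 by rewrite exprn_gt0.
have i0 : 0 < n%:R^-1 :> R by rewrite invr_gt0.
have lm k : - (l * M) <= l * mres k <= l * M.
  have /andP[h1 h2] := mres_bound k.
  by rewrite -mulrN !ler_pM2l// h1 h2.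
have lsg : 0 <= l ^+ 2 * sg2 <= l ^+ 2.
  have sg20 : 0 <= sg2 by apply: le_trans sg2l; lra.
  have sg21 : sg2 <= 1 by apply: le_trans sg2u _; lra.
  by rewrite (mulr_ge0 (ltW l20) sg20) (ler_piMr (ltW l20) sg21).
pose Z i w := expR (- l * residual i w).
pose e i := expR (- l * mres i + (- l) ^+ 2 * sg2 / 2).
have mZ i : measurable_fun setT (Z i) by exact: measurable_expR_residual.
have Z0 i w : 0 <= Z i w by exact: expR_ge0.
have eZ i : (\int[P]_w (Z i w)%:E = (e i)%:E)%E by exact: mgf1_residual.
have ZZ i k : (\int[P]_w (Z i w * Z k w)%:E = (expR (- l * (mres i + mres k) +
     (- l) ^+ 2 * (sg2 + (1 - rho) * ((i == k)%:R - n%:R^-1))))%:E)%E.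
  exact: mgf_residual.
have iZ i : P.-integrable setT (EFin \o Z i).
  apply/integrableP; split; first exact/measurable_EFinP.
  by under eq_integral do rewrite /= ger0_norm//; rewrite eZ ltry.
have iZZ i k : P.-integrable setT (fun w => (Z i w * Z k w)%:E).
  apply/integrableP; split; first by apply/measurable_EFinP; exact: measurable_funM.
  by under eq_integral do rewrite /= ger0_norm ?mulr_ge0//; rewrite ZZ ltry.
have Z2 i : (\int[P]_w (Z i w * Z i w)%:E <= Q%:E)%E.
  rewrite ZZ lee_fin ler_expR eqxx sqrrN -/sg2 -mulr2n /=.
  by have /andP[h1 h2] := lm i; have /andP[h3 h4] := lsg; lra.
have Zlk i k : i != k -> (\int[P]_w (Z i w * Z k w)%:E <= (e i * e k)%:E)%E.
  move=> /negbTE ik; rewrite ZZ lee_fin -expRD ler_expR ik sqrrN sub0r.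
  have : 0 <= l ^+ 2 * ((1 - rho) * n%:R^-1).
    by rewrite mulr_ge0 ?ltW// mulr_gt0// subr_gt0.
  by lra.
have E0e i : E0 <= e i.
  rewrite ler_expR sqrrN; have /andP[h1 h2] := lm i.
  have : l ^+ 2 * ((1 - rho) / 2) <= l ^+ 2 * sg2 by rewrite ler_pM2l.
  by lra.
have E01 : 2 <= E0 by apply: le_trans hl; rewrite lerDr mulr_ge0// expR_ge0.
have nE0 : n%:R * E0 <= \sum_i e i by rewrite -sum_cst; exact: ler_sum.
(* Deviation by half the mean. As every [e i] is at least [E0 >= 2], [t >= n], so the Chebyshev
   bound is at most [Q / n], which [hn] controls. *)
pose t := (\sum_i e i) / 2.
have nt : n%:R <= t.
  rewrite /t ler_pdivlMr//; apply: le_trans nE0.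
  by rewrite ler_pM2l.
have t0 : 0 < t by apply: lt_le_trans nt.
(* The expectation of [W] is at most [n * Q], so Markov's inequality at level [n * B] costs
   [Q / B = eps / 2]. *)
pose B := 2 * Q / eps; have B0 : 0 < B by rewrite divr_gt0// mulr_gt0.
pose W w := \sum_i expR (- (2 * l) * residual i w).
have mW : measurable_fun setT W.
  by apply: measurable_sum => i; exact: measurable_expR_residual.
pose G1 := [set w | \sum_i Z i w <= \sum_i e i - t].
pose G2 := [set w | n%:R * B <= W w].
have mG1 : measurable G1 by apply: measurable_sublevel; exact: measurable_sum.
have mG2 : measurable G2 by exact: measurable_superlevel.
exists (G1 `|` G2); split; first exact: measurableU.
- apply: (le_trans (measureU2 _ _ _)) => //.
  have -> : eps = eps / 2 + eps / 2 by lra.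
  rewrite EFinD; apply: leeD.
    apply: (le_trans (sum_lower_tail t0 mZ iZ iZZ eZ Z2 Zlk)).
    rewrite lee_fin ler_pdivrMr ?exprn_gt0//.
    have : n%:R * n%:R <= t ^+ 2 by rewrite expr2 ler_pM// ltW.
    rewrite ler_pdivrMr// in hn.
    by nra.
  apply: (@le_trans _ _ (n%:R * Q / (n%:R * B))%:E).
    apply: markov_ge0 => //.
    - by move=> w; apply: sumr_ge0 => i _; exact: expR_ge0.
    - exact: mulr_gt0.
    under eq_integral do rewrite -sumEFin.
    rewrite ge0_integral_sum//.
    - rewrite -sum_cst -sumEFin; apply: lee_sum => i _.
      rewrite mgf1_residual lee_fin ler_expR.
      by have /andP[h1 h2] := lm i; have /andP[h3 h4] := lsg; lra.
    - by move=> i; apply/measurable_EFinP; exact: measurable_expR_residual.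
  rewrite lee_fin le_eqVlt; apply/orP; left; apply/eqP.
  by rewrite /B; field; rewrite n_neq0 !gt_eqF.
- move=> w /not_orP[/negP nG1 /negP nG2].
  rewrite /= -ltNge in nG1; rewrite /= -ltNge in nG2.
  (* This [dl] caps the quadratic term at [n / 2] and gives the count the coefficient [B / 2]; since
     the sum of [Z] exceeds [n * expR (l * a) + n], it follows that [n <= N * B]. *)
  have dl0 : 0 < 1 / (2 * B) by rewrite divr_gt0// mulr_gt0.
  have := count_le_exp (fun i => residual i w) a (ltW l0) dl0.
  rewrite -/(W w); set N := #|_|%:R => h.
  have WB : 1 / (2 * B) * W w <= n%:R / 2.
    have -> : n%:R / 2 = 1 / (2 * B) * (n%:R * B) by field; rewrite gt_eqF.
    by rewrite ler_pM2l// ltW.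
  have NB : N / (4 * (1 / (2 * B))) = N * B / 2 by field; rewrite gt_eqF.
  have nZ : n%:R * expR (l * a) + n%:R < \sum_i Z i w.
    apply: le_lt_trans nG1; rewrite /t.
    have : n%:R * (2 * expR (l * a) + 2) <= n%:R * E0 by rewrite ler_pM2l.
    by lra.
  have : n%:R <= N * B by move: h nZ WB; rewrite NB /Z; lra.
  rewrite -ler_pdivrMr// (_ : eps / (2 * Q) = B^-1)//.
  by rewrite /B invf_div.
Qed.

End centered.

(** * Measurability of the error event and the bound on its probability *)

(** By [eq_hommel] the event is determined by the finitely many comparisons [B], so
    [measurable_saturated] applies. *)
Lemma measurable_FWER_event {R : realType} {d : measure_display}
  {Omega : measurableType d} (P : probability Omega R) (n : nat) (alpha : R)
  (mu : 'I_n -> R) (X : 'I_n -> {RV P >-> R}) :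
  measurable [set w | (1 <= type1_errors (hommel alpha) mu (fun i => X i w))%N].
Proof.
pose B (j : 'I_n.+1 * 'I_n.+1 * 'I_n) : set Omega :=
  [set w | 1 - Phi (X j.2 w) <= j.1.1%:R * alpha / j.1.2%:R].
apply: (@measurable_saturated _ _ _ B) => [j|x y Bxy].
  apply: measurable_sublevel; apply: measurable_funB => //.
  by apply: measurableT_comp; [exact: measurable_Phi|exact: measurable_funPT].
rewrite /= /type1_errors (@eq_hommel _ _ _ (pvalue (fun i => X i y)))// => k i l.
by apply/idP/idP; have [h1 h2] := Bxy (k, i, l); [exact: h1|exact: h2].
Qed.

Lemma measure_exists_le {R : realType} {d : measure_display}
  {Omega : measurableType d} (P : probability Omega R) (n : nat)
  (A : 'I_n -> set Omega) (c : R) :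
  (forall i, measurable (A i)) -> (forall i, (P (A i) <= c%:E)%E) ->
  (P (\bigcup_(i in [set: 'I_n]) A i) <= (n%:R * c)%:E)%E.
Proof.
move=> mA PA.
apply: (@le_trans _ _ (\sum_(i \in [set: 'I_n]) P (A i))%E).
  apply: content_sub_fsum => //; first exact: finite_finset.
  by apply: fin_bigcup_measurable => //; exact: finite_finset.
rewrite (_ : [set: 'I_n] = [set` enum 'I_n]); last first.
  by apply/seteqP; split=> i _ //=; rewrite mem_enum.
rewrite -fsbig_seq ?enum_uniq// big_enum/=.
rewrite (_ : n%:R * c = \sum_(i < n) c); last by rewrite sumr_const card_ord mulr_natl.
by rewrite -sumEFin; apply: lee_sum => i _.
Qed.

(** The right exponent is quadratic in [l], so a large [l] puts it above [l * a + 2]; then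
    [expR 1 >= 2] gives a right side of at least [4 * expR (l * a)]. *)
Lemma exponent_exists {R : realType} (rho M a : R) :
  rho < 1 -> 0 <= M -> 0 <= a -> exists2 l, 0 < l &
    2 * expR (l * a) + 2 <= expR (- (l * M) + l ^+ 2 * (1 - rho) / 4).
Proof.
move=> rho1 M0 a0; have r0 : 0 < 1 - rho by rewrite subr_gt0.
pose l := 1 + 4 * (M + a + 2) / (1 - rho).
have q0 : 0 <= 4 * (M + a + 2) / (1 - rho).
  by rewrite divr_ge0// ?ltW//; lra.
have l1 : 1 <= l by rewrite /l; lra.
have l0 : 0 < l by lra.
have hl : M + a + 2 <= l * (1 - rho) / 4.
  have -> : l * (1 - rho) / 4 = (1 - rho) / 4 + (M + a + 2).
    by rewrite /l; field; rewrite gt_eqF.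
  by lra.
exists l => //.
have h1 : l * (M + a + 2) <= l * (l * (1 - rho) / 4) by rewrite ler_pM2l.
have h2 : l * a + 1 + 1 <= - (l * M) + l ^+ 2 * (1 - rho) / 4 by lra.
apply: (@le_trans _ _ (expR (l * a + 1 + 1))); last by rewrite ler_expR.
have e1 : 2 <= expR 1 :> R by have := expR_ge1Dx (1 : R); lra.
have e2 : 1 <= expR (l * a) by rewrite -expR0 ler_expR mulr_ge0// ltW.
rewrite !expRD.
have : expR (l * a) * 2 <= expR (l * a) * expR 1 by rewrite ler_wpM2l ?expR_ge0.
have : expR (l * a) * expR 1 * 2 <= expR (l * a) * expR 1 * expR 1.
  by rewrite ler_wpM2l// mulr_ge0 ?expR_ge0.
lra.
Qed.

(** Three exceptional events share [eps] equally: [B1] (large sample mean), [G] (too few low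
    residuals) and [B2U] (some scaled residual in the extreme tail). All constants are fixed before
    [n], [mu] and [X]. *)
Lemma FWER_hommel_le {R : realType} (rho alpha M eps : R) :
  0 < rho < 1 -> 0 < alpha < 1 -> 0 <= M -> 0 < eps ->
  exists n0 : nat, forall n, (n0 <= n)%N ->
    forall (d : measure_display) (Omega : measurableType d)
      (P : probability Omega R) (mu : 'I_n -> R) (X : 'I_n -> {RV P >-> R}),
    (forall i, 0 <= mu i <= M) -> jointly_normal X ->
    (forall i, is_normal P (X i) (mu i) 1) ->
    (forall i j, i != j -> correlation (X i) (X j) = rho) ->
    (FWER (hommel alpha) mu X <= eps%:E)%E.
Proof.
move=> rho01 /andP[al0 al1] M0 eps0; have /andP[rho0 rho1] := rho01.
pose e := eps / 3; have e0 : 0 < e by rewrite divr_gt0.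
(* Turns the tail bound of the sample mean into [expR (- e^-1) <= e]. *)
pose K := M + 2^-1 + e^-1.
have ei0 : 0 < e^-1 by rewrite invr_gt0.
have K0 : 0 < K by rewrite /K; lra.
have [z0 Phiz0] : exists z, Phi z < 1 - alpha by apply: Phi_to0; lra.
(* If the mean is below [K], a residual at most [- a] gives [X_i <= K - a <= z0], hence a p-value
   above [alpha]. *)
pose a := `|K - z0|; have a0 : 0 <= a by exact: normr_ge0.
have [l l0 hl] := exponent_exists rho1 M0 a0.
pose Q := expR (2 * l * M + 2 * l ^+ 2); have Q0 : 0 < Q by exact: expR_gt0.
pose c := e / (2 * Q); have c0 : 0 < c by rewrite divr_gt0// mulr_gt0.
pose r := Num.sqrt (1 - rho).
have r2 : r ^+ 2 = 1 - rho by rewrite sqr_sqrtr// subr_ge0 ltW.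
have r0 : 0 < r by rewrite sqrtr_gt0 subr_gt0.
have r1 : r < 1 by rewrite -(ltr_pM2l r0) -expr2 r2 mulr1; nra.
(* The factor [th > 1] absorbs the bound [K] on the sample mean: if [X_i] is large
   and the mean is below [K] then [X_i <= th * (X_i - mean)], while [th * (X_i - mean)]
   still has standard deviation at most [s0 < 1]. *)
pose th := (1 + r) / (2 * r).
have th1 : 1 < th by rewrite /th ltr_pdivlMr ?mulr_gt0//; lra.
have th0 : 0 < th by lra.
pose s0 := (1 + r) / 2.
have s01 : 0 < s0 < 1 by rewrite /s0; apply/andP; split; lra.
have ths0 : th ^+ 2 * (1 - rho) = s0 ^+ 2.
  by rewrite -r2 /th /s0; field; rewrite gt_eqF.
(* Chosen so that the union bound over [n] residuals at level [en = alpha / (c * n)] totals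
   [n * eta * en = e]. *)
pose eta := e * c / alpha; have eta0 : 0 < eta by rewrite divr_gt0// mulr_gt0.
have [e1 e10 tail] := normal_upper_tail (mulr_ge0 (ltW th0) M0) s01 eta0.
(* The point from which [x <= th * (x - K)] holds; [e2] is a p-value level that forces [x >= x1]. *)
pose x1 := th * K / (th - 1).
pose e2 := (1 - Phi x1) / 2.
have Phix1 : 0 < 1 - Phi x1 by rewrite subr_gt0 Phi_lt1.
have e20 : 0 < e2 by rewrite divr_gt0.
have x1P x : 1 - Phi x <= e2 -> x1 <= x.
  move=> h; rewrite leNgt; apply/negP => xx1.
  have h' := Phi_nondecreasing (ltW xx1); move: h; rewrite /e2 => h.
  by clear -h h' Phix1; lra.
(* The summands ensure in turn [2 <= n], the size condition of [residual_lower_count], [en <= e1]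
   and [en <= e2]. *)
pose B := 2 + 8 * Q / e + alpha / (c * e1) + alpha / (c * e2).
exists (Num.truncn B).+1 => n nB d Omega P mu X mu0M Xj Xm Xc.
have nR : B <= n%:R.
  by apply/ltW; apply: lt_le_trans (truncnS_gt B) _; rewrite ler_nat.
have t1 : 0 <= 8 * Q / e by apply: ltW; rewrite divr_gt0// mulr_gt0.
have t2 : 0 <= alpha / (c * e1) by apply: ltW; rewrite divr_gt0// mulr_gt0.
have t3 : 0 <= alpha / (c * e2) by apply: ltW; rewrite divr_gt0// mulr_gt0.
have [ge2n nQ na1 na2] : [/\ 2 <= n%:R :> R, 8 * Q / e <= n%:R,
    alpha / (c * e1) <= n%:R & alpha / (c * e2) <= n%:R].
  move: t1 t2 t3 nR; rewrite /B; move: (8 * Q / e) (alpha / _) (alpha / _) n%:R.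
  by clear => *; split; lra.
have n2 : (2 <= n)%N by rewrite -(ler_nat R).
have n0 : 0 < n%:R :> R by rewrite ltr0n (leq_trans _ n2).
(* Outside [B1] and [G] at least [c * n] p-values exceed [alpha], so [en] bounds every rejected
   p-value. *)
pose en := alpha / (c * n%:R).
have en0 : 0 < en by rewrite divr_gt0// mulr_gt0.
have en_le x : 0 < x -> alpha / (c * x) <= n%:R -> en <= x.
  move=> x0; rewrite /en (ler_pdivrMr _ _ (mulr_gt0 c0 x0)) (ler_pdivrMr _ _ (mulr_gt0 c0 n0)).
  by rewrite (_ : x * (c * n%:R) = n%:R * (c * x)); last by ring.
have ene1 : en <= e1 by exact: en_le.
have ene2 : en <= e2 by exact: en_le.
pose Xb := sample_mean X; pose Y := residual X.
pose B1 := [set w | K <= Xb w].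
have [G [mG PG GP]] := residual_lower_count rho01 n2 mu0M Xj Xm Xc l0 e0 hl nQ.
pose B2 i := [set w | 1 - Phi (th * Y i w) <= en].
have mXb : measurable_fun setT Xb by exact: measurable_sample_mean.
have mthY i : measurable_fun setT (fun w => th * Y i w).
  by apply: measurable_funM => //; exact: measurable_residual.
have mB1 : measurable B1 by exact: measurable_superlevel.
have mB2 i : measurable (B2 i).
  apply: measurable_sublevel; apply: measurable_funB => //.
  by apply: measurableT_comp => //; exact: measurable_Phi.
have PB1 : (P B1 <= e%:E)%E.
  apply: (le_trans (sample_mean_upper_tail rho01 n2 mu0M Xj Xm Xc K)).
  rewrite (_ : - K + M + 2^-1 = - e^-1); last by rewrite /K; clear; ring.
  rewrite lee_fin expRN invf_ple ?posrE ?expR_gt0//.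
  by apply: le_trans (expR_ge1Dx _); rewrite lerDr.
have PB2 i : (P (B2 i) <= (eta * en)%:E)%E.
  have [m [s [mM s_gt0 s2 nY]]] := scaled_residual_is_normal rho01 n2 mu0M Xj Xm Xc i th0.
  rewrite !ths0 in s2.
  apply: (tail en _ m s) => //; first by rewrite en0.
pose B2U := \bigcup_(i in [set: 'I_n]) B2 i.
have mB2U : measurable B2U by apply: fin_bigcup_measurable => //; exact: finite_finset.
have PB2U : (P B2U <= e%:E)%E.
  apply: (le_trans (measure_exists_le mB2 PB2)).
  rewrite lee_fin le_eqVlt; apply/orP; left; apply/eqP.
  by rewrite /eta /en; field; rewrite !gt_eqF.
apply: (@le_trans _ _ (P (B1 `|` G `|` B2U))); last first.
  apply: (le_trans (measureU2 _ _ _)) => //; first exact: measurableU.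
  rewrite (_ : eps = e + e + e); last by rewrite /e; clear; field.
  rewrite EFinD leeD//.
  by apply: (le_trans (measureU2 _ _ _)) => //; rewrite EFinD leeD.
apply: le_measure; rewrite ?inE.
- exact: measurable_FWER_event.
- by apply: measurableU => //; exact: measurableU.
move=> w /= Ew; apply: contrapT => /not_orP[/not_orP[nB1 nG] nB2].
move/negP : nB1; rewrite -ltNge => XbK.
have := GP w nG; set N' := #|_| => cN'.
move: Ew; rewrite /type1_errors card_gt0 => /set0Pn[i].
rewrite inE => /andP[rej _].
set p := pvalue _ in rej; set N := #|[set k | (alpha < p k)%R]%SET|.
have N'N : (N' <= N)%N.
  apply: subset_leq_card; apply/fintype.subsetP => k; rewrite !inE => Yk.
  have Xk : X k w <= z0.
    move: Yk; rewrite /residual /a -/(Xb w).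
    have := ler_norm (K - z0) => h1 h2.
    by clear -h1 h2 XbK; lra.
  rewrite /p /pvalue; have h := Phi_nondecreasing Xk.
  by clear -h Phiz0; lra.
have cN : c * n%:R <= N%:R.
  by apply: (@le_trans _ _ N'%:R); rewrite ?ler_nat// mulrC.
have cn0 : 0 < c * n%:R by rewrite mulr_gt0.
have N0 : (0 < N)%N by rewrite -(ltr_nat R); apply: lt_le_trans cN.
have pi_en : p i <= en.
  apply: (le_trans (hommel_reject_le al0 N0 rej)).
  by rewrite ler_pM2l// lef_pV2 ?posrE// ltr0n.
have Xi : x1 <= X i w by apply: x1P; apply: le_trans ene2.
have XY : X i w <= th * Y i w.
  have h1 : th * K <= X i w * (th - 1).
    by rewrite -ler_pdivrMr ?subr_gt0.
  have h2 : th * (X i w - K) <= th * Y i w.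
    by rewrite ler_pM2l// lerD2l lerN2 ltW.
  by clear -h1 h2; lra.
apply: nB2; exists i => //; rewrite /B2 /=.
by apply: le_trans pi_en; rewrite /p /pvalue lerD2l lerN2 Phi_nondecreasing.
Qed.

Theorem corollary5p1 (R : realType) (rho alpha : R)
  (rho01 : 0 < rho < 1) (alpha01 : 0 < alpha < 1)
  (mu : nat -> R) (mu_ge0 : forall i, 0 <= mu i)
  (mu_sup : (ereal_sup (range (fun i => (mu i)%:E)) < +oo)%E)
  (d : nat -> measure_display) (Omega : forall n, measurableType (d n))
  (P : forall n, probability (Omega n) R)
  (X : forall n, 'I_n -> {RV (P n) >-> R})
  (X_joint : forall n, jointly_normal (X n))
  (X_marginal : forall n (i : 'I_n), is_normal (P n) (X n i) (mu i) 1)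
  (X_corr : forall n (i j : 'I_n), i != j -> correlation (X n i) (X n j) = rho) :
  FWER (hommel alpha) (fun i : 'I_n => mu i) (X n) @[n --> \oo] --> 0%E.
Proof.
have [M muM] : exists M, forall i, 0 <= mu i <= M.
  have sub i : ((mu i)%:E <= ereal_sup (range (fun i => (mu i)%:E)))%E.
    by apply: ereal_sup_ubound; exists i.
  move: mu_sup sub; case: (ereal_sup _) => [M _ sub|//|_ sub].
    by exists M => i; rewrite mu_ge0 -lee_fin sub.
  (* The supremum cannot be [-oo], since it dominates the real number [mu 0]. *)
  by have := sub 0%N; rewrite leeNy_eq.
have M0 : 0 <= M by have /andP[] := muM 0%N; exact: le_trans.
have bound eps : 0 < eps -> \forall n \near \oo,
    (0 <= FWER (hommel alpha) (fun i : 'I_n => mu i) (X n) <= eps%:E)%E.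
  move=> eps0; have [n0 Hn0] := FWER_hommel_le rho01 alpha01 M0 eps0.
  exists n0 => // n /= n0n; rewrite measure_ge0/=.
  exact: (Hn0 n n0n _ _ _ _ _ (fun i => muM i) (X_joint n) (X_marginal n) (X_corr n)).
apply/fine_cvgP; split.
  apply: filterS (bound 1 ltr01) => n /andP[h0 h1].
  by rewrite ge0_fin_numE// (le_lt_trans h1)// ltry.
apply/cvgr0Pnorm_le => eps eps0; apply: filterS (bound eps eps0) => n /andP[h0 h1].
have fin : FWER (hommel alpha) (fun i : 'I_n => mu i) (X n) \is a fin_num.
  by rewrite ge0_fin_numE// (le_lt_trans h1)// ltry.
by rewrite /= ger0_norm ?fine_ge0// -lee_fin fineK.
Qed.
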